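(* Let $0<\rho<1$. The conjugate function of $f_\rho$ is a rescaled SoftPlus: for every $s\in\mathbb{R}$, $$f_\rho^*(s):=\sup_{t\ge0}\{st-f_\rho(t)\}=\frac1\rho\log\left(1+\rho e^s\right)-1 .$$ Therefore, for every probability measure $\mu$ on a measurable space $\mathcal{X}$ and every measurable function $\varphi:\mathcal{X}\to\mathbb{R}$, $$F_\rho(\varphi;\mu)=\inf_{\alpha\in\mathbb{R}}\left\{\alpha-1+\frac1\rho\int_{\mathcal{X}}\log\left(1+\rho e^{\varphi(x)-\alpha}\right)d\mu(x)\right\}.$$
   Context: For $0<\rho<1$, define $f_\rho$ on $[0,\infty)$ by $f_\rho(t)=t\log t+1+\frac{1-\rho t}{\rho}\log(1-\rho t)$ for $0\le t\le\frac1\rho$ (with $0\log0=0$) and $f_\rho(t)=+\infty$ otherwise. The Safe KL divergence is $D_\rho(\nu,\mu):=\int_{\mathcal{X}}f_\rho\left(\frac{d\nu}{d\mu}(x)\right)d\mu(x)$ if $\nu\ll\mu$ and $+\infty$ otherwise. With $\mathcal{P}(\mathcal{X})$ the set of probability measures on $\mathcal{X}$, $$F_\rho(\varphi;\mu):=\sup_\nu\left\{\int_{\mathcal{X}}\varphi\,d\nu-D_\rho(\nu,\mu):\ \nu\in\mathcal{P}(\mathcal{X}),\ \int_{\mathcal{X}}|\varphi|\,d\nu<\infty\right\}.$$ *)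

(* Defs.v *)
From HB Require Import structures.
From mathcomp Require Import all_boot all_order all_algebra.
From mathcomp Require Import all_classical all_reals all_analysis.

Set Implicit Arguments.
Unset Strict Implicit.
Unset Printing Implicit Defensive.

Import Order.TTheory GRing.Theory Num.Theory.
Import numFieldNormedType.Exports.

Local Open Scope classical_set_scope.
Local Open Scope ring_scope.
Local Open Scope charge_scope.

(* The value +oo for t < 0 is only a totalization: the function is meant on
   [0, +oo[. The convention 0 log 0 = 0, needed at t = 0 and t = 1 / rho, holds
   because [ln 0] is a real number. *)
Definition safe_kl_fun (R : realType) (rho : R) (t : R) : \bar R :=
  if 0 <= t <= 1 / rho then
    (t * ln t + 1 + (1 - rho * t) / rho * ln (1 - rho * t))%:E
  else +oo%E.

Definition conjugate_nonneg (R : realType) (f : R -> \bar R) (s : R) : \bar R :=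
  ereal_sup [set ((s * t)%:E - f t)%E | t in [set t : R | 0 <= t]].

(* Under nu `<< mu the library's Radon-Nikodym derivative is finite everywhere,
   so that [fine] loses no information. *)
Definition safe_kl (d : measure_display) (T : measurableType d) (R : realType)
    (rho : R) (nu mu : probability T R) : \bar R :=
  if `[< nu `<< mu >] then
    (\int[mu]_x
       safe_kl_fun rho (fine (('d (charge_of_finite_measure nu) '/d mu) x)))%E
  else +oo%E.

Definition safe_kl_dual (d : measure_display) (T : measurableType d)
    (R : realType) (rho : R) (phi : T -> R) (mu : probability T R) : \bar R :=
  ereal_sup [set (\int[nu]_x (phi x)%:E - safe_kl rho nu mu)%E
            | nu in [set nu : probability T R
                    | (\int[nu]_x `|phi x|%:E < +oo)%E]].

(* Main.v *)
(* The Fenchel-Young inequality s t <= f_rho(t) + f_rho^*(s) is the Gibbs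
   inequality between the two-point distributions (rho t, 1 - rho t) and
   (rho u, 1 - rho u), u = logistic s = 1 / (rho + e^-s), with equality at
   t = u. Applied to s = phi - a and t = dnu/dmu and integrated against mu, it
   bounds the dual functional by the objective at every a.
   For the converse, if the positive part of phi is mu-integrable, then by
   dominated convergence and the intermediate value theorem some a makes
   logistic (phi - a) a probability density, which turns Fenchel-Young into an
   equality. Otherwise both sides are infinite: f_rho is bounded on [0, 1 / rho],
   and conditioning mu on [- N <= phi <= n] makes the integral of phi arbitrarily
   large. *)

Require Import Defs.
From HB Require Import structures.
From mathcomp Require Import all_boot all_order all_algebra.
From mathcomp Require Import all_classical all_reals all_analysis.
From mathcomp Require Import measurable_realfun.
From mathcomp Require Import ring lra.

Set Implicit Arguments.
Unset Strict Implicit.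
Unset Printing Implicit Defensive.

Import Order.TTheory GRing.Theory Num.Theory.
Import numFieldNormedType.Exports.

Local Open Scope classical_set_scope.
Local Open Scope ring_scope.

(** For $a > 0$ this is $\ln(b/a) \le b/a - 1$ multiplied by $a$. Summed over the two atoms, it
    gives the Gibbs inequality. *)
Lemma sub_le_mul_ln (R : realType) (a b : R) : 0 <= a -> 0 < b ->
  a - b <= a * ln a - a * ln b.
Proof.
rewrite le_eqVlt => /predU1P[<- b0|a0 b0].
  by rewrite !mul0r subr0 sub0r oppr_le0 ltW.
have /le_ln1Dx : -1 < b / a - 1 by rewrite ltrDr divr_gt0.
rewrite addrC subrK ln_div ?posrE// => h.
have : a * (ln b - ln a) <= a * (b / a - 1) by rewrite ler_pM2l.
rewrite !mulrBr mulrCA divff ?gt_eqF// !mulr1 => h'; lra.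
Qed.

(** * Pointwise Fenchel-Young theory of $f_\rho$ *)

Section safe_kl_conjugate.
Context {R : realType}.
Variable rho : R.
Hypothesis rho0 : 0 < rho.
Implicit Types s t : R.

(** This is $f_\rho^* + 1$. The added 1 makes it nonnegative, so that its integral makes sense for
    every measurable [phi]. *)
Definition softplus s : R := 1 / rho * ln (1 + rho * expR s).

(** The derivative of [softplus], hence the maximizer of $st - f_\rho(t)$. In this form the bounds
    by $1/\rho$ and $e^s$ and the continuity are immediate. *)
Definition logistic s : R := (rho + expR (- s))^-1.

Let den_gt0 s : 0 < rho + expR (- s).
Proof. by rewrite addr_gt0// expR_gt0. Qed.

Let arg_gt1 s : 1 < 1 + rho * expR s.
Proof. by rewrite ltrDl mulr_gt0// expR_gt0. Qed.

Let arg_gt0 s : 0 < 1 + rho * expR s.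
Proof. exact: lt_trans (arg_gt1 s). Qed.

Lemma softplus_ge0 s : 0 <= softplus s.
Proof. by rewrite mulr_ge0 ?divr_ge0 ?ln_ge0 ?ltW. Qed.

Lemma logistic_gt0 s : 0 < logistic s.
Proof. by rewrite invr_gt0. Qed.

Lemma logistic_ge0 s : 0 <= logistic s.
Proof. exact/ltW/logistic_gt0. Qed.

Lemma logistic_lt s : logistic s < 1 / rho.
Proof. by rewrite div1r ltf_pV2 ?posrE// ltrDl expR_gt0. Qed.

Lemma logistic_le_expR s : logistic s <= expR s.
Proof.
by rewrite -[leRHS]invrK -expRN lef_pV2 ?posrE ?expR_gt0// lerDr ltW.
Qed.

Lemma logisticE s : logistic s = expR s / (1 + rho * expR s).
Proof.
rewrite /logistic expRN; field.
by rewrite !gt_eqF ?expR_gt0// arg_gt0.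
Qed.

Lemma ln_logistic s : ln (logistic s) = s - ln (1 + rho * expR s).
Proof. by rewrite logisticE ln_div ?posrE ?expR_gt0// expRK. Qed.

Lemma one_sub_logistic s : 1 - rho * logistic s = (1 + rho * expR s)^-1.
Proof. by rewrite logisticE; field; rewrite gt_eqF. Qed.

(** The equality case of Fenchel-Young: with $t$ = [logistic s], the coefficients $-t$ and $-(1 -
    \rho t)/\rho$ of $\ln(1 + \rho e^s)$ add up to $-1/\rho$. *)
Lemma safe_kl_fun_logistic s :
  safe_kl_fun rho (logistic s) = (s * logistic s + 1 - softplus s)%:E.
Proof.
rewrite /safe_kl_fun logistic_ge0 ltW ?logistic_lt//=; congr EFin.
rewrite one_sub_logistic lnV ?posrE// -one_sub_logistic ln_logistic /softplus.
by field; rewrite gt_eqF.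
Qed.

Lemma safe_kl_fun_young s t :
  ((s * t + 1)%:E <= safe_kl_fun rho t + (softplus s)%:E)%E.
Proof.
rewrite /safe_kl_fun; case: ifPn => [/andP[t0 t1]|_]; last first.
  by rewrite addye ?leey.
rewrite -EFinD lee_fin.
have q0 : 0 <= 1 - rho * t.
  by rewrite subr_ge0 mulrC -ler_pdivlMr.
(* With $u$ = [logistic s], the inequality for $(t, u)$ is added to $1/\rho$ times the one for $(1 -
   \rho t, 1 - \rho u)$; the left sides $t - u$ and $u - t$ cancel. *)
have := sub_le_mul_ln t0 (logistic_gt0 s).
have := @sub_le_mul_ln _ _ (1 + rho * expR s)^-1 q0.
rewrite invr_gt0 => /(_ (arg_gt0 s)).
rewrite -{1}one_sub_logistic lnV ?posrE// ln_logistic /softplus.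
set L := ln (1 + _); set l := ln (1 - _) => h1 h2.
have e1 : 1 / rho * (1 - rho * t - (1 - rho * logistic s)) = logistic s - t.
  by field; rewrite gt_eqF.
have e2 : 1 / rho * ((1 - rho * t) * l - (1 - rho * t) * - L) =
    (1 - rho * t) / rho * l + 1 / rho * L - t * L.
  by field; rewrite gt_eqF.
have : 1 / rho * (1 - rho * t - (1 - rho * logistic s)) <=
    1 / rho * ((1 - rho * t) * l - (1 - rho * t) * - L).
  by rewrite ler_pM2l ?divr_gt0.
by rewrite e1 e2; lra.
Qed.

(** Fenchel-Young at $s = 0$, where [softplus] equals $\ln(1 + \rho)/\rho \le 1$. *)
Lemma safe_kl_fun_ge0 t : (0 <= safe_kl_fun rho t)%E.
Proof.
have := safe_kl_fun_young 0 t.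
have : softplus 0 <= 1.
  rewrite /softplus expR0 mulr1 div1r mulrC ler_pdivrMr// mul1r le_ln1Dx//.
  exact: lt_trans (ltrN10 _) rho0.
case: safe_kl_fun => //= r.
rewrite -EFinD !lee_fin; lra.
Qed.

Lemma conjugate_safe_kl_fun s :
  conjugate_nonneg (safe_kl_fun rho) s = (softplus s - 1)%:E.
Proof.
apply/eqP; rewrite eq_le; apply/andP; split.
  apply: ge_ereal_sup => _ [t _ <-].
  have := safe_kl_fun_young s t.
  case: (safe_kl_fun rho t) => //= [r|_]; last by rewrite leNye.
  rewrite -!EFinB !lee_fin; lra.
apply: ereal_sup_ubound; exists (logistic s); first exact: logistic_ge0.
by rewrite safe_kl_fun_logistic -EFinB; congr EFin; ring.
Qed.

Lemma measurable_safe_kl_fun : measurable_fun [set: R] (safe_kl_fun rho).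
Proof.
have mlin : measurable_fun [set: R] (fun t => 1 - rho * t).
  by apply: measurable_funB => //; exact: mulrl_measurable.
apply: measurable_fun_ifT => //.
- by apply: measurable_and; apply: measurable_fun_ler.
- apply/measurable_EFinP; apply: measurable_funD.
    apply: measurable_funD => //; exact: measurable_funM.
  apply: measurable_funM; first exact: measurable_funM.
  exact: measurableT_comp.
Qed.

Lemma measurable_softplus : measurable_fun [set: R] softplus.
Proof.
apply: measurable_funM => //; apply: measurableT_comp => //.
by apply: measurable_funD => //; apply: measurable_funM.
Qed.

Lemma continuous_logistic : continuous logistic.
Proof.
move=> s; apply: cvgV; first by rewrite gt_eqF.
apply: cvgD; first exact: cvg_cst.
apply: continuous_comp; first exact: opp_continuous.
exact: continuous_expR.
Qed.

Lemma measurable_logistic : measurable_fun [set: R] logistic.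
Proof. apply: continuous_measurable_fun; exact: continuous_logistic. Qed.

End safe_kl_conjugate.

(** * Construction of a probability measure from a density *)

Section density_probability.
Context d (T : measurableType d) (R : realType).
Variables (mu : {measure set T -> \bar R}) (g : T -> R).
Local Open Scope ereal_scope.

(* The hypotheses are arguments so that the measure structure can be attached
   to this definition. *)
Definition density_measure of measurable_fun [set: T] g
    & (forall x, (0 <= g x)%R) & \int[mu]_x (g x)%:E = 1 : set T -> \bar R :=
  fun A => \int[mu]_(x in A) (g x)%:E.

Hypotheses (mg : measurable_fun [set: T] g) (g0 : forall x, (0 <= g x)%R).
Hypothesis g1 : \int[mu]_x (g x)%:E = 1.
Local Notation nu := (density_measure mg g0 g1).

Let nu0 : nu set0 = 0.
Proof. by rewrite /density_measure integral_set0. Qed.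

Let nu_ge0 A : 0 <= nu A.
Proof. by apply: integral_ge0 => x _; rewrite lee_fin. Qed.

Let nu_sigma_additive : semi_sigma_additive nu.
Proof.
move=> /= F mF tF mUF; rewrite /density_measure; apply: cvg_toP.
  apply: ereal_nondecreasing_is_cvgn => m n mn.
  by apply: lee_sum_nneg_natr => // k _ _; exact: nu_ge0.
rewrite ge0_integral_bigcup//=.
- by apply: measurable_funTS; exact/measurable_EFinP.
- by move=> x _; rewrite lee_fin.
Qed.

HB.instance Definition _ := isMeasure.Build _ _ _ nu
  nu0 nu_ge0 nu_sigma_additive.

HB.instance Definition _ := @Measure_isProbability.Build _ _ R nu g1.

Lemma exists_density_probability : exists nu : probability T R,
  forall A, measurable A -> nu A = \int[mu]_(x in A) (g x)%:E.
Proof. by exists nu. Qed.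

End density_probability.

(** * Integrals and divergence expressed through a density *)

Section density.
Context d (T : measurableType d) (R : realType).
Variables (nu mu : probability T R) (g : T -> R).
Local Open Scope ereal_scope.
Local Open Scope charge_scope.

Hypotheses (mg : measurable_fun [set: T] g) (g0 : forall x, (0 <= g x)%R).
Hypothesis nug :
  forall A, measurable A -> nu A = \int[mu]_(x in A) (g x)%:E.

Let mEg : measurable_fun [set: T] (EFin \o g).
Proof. exact/measurable_EFinP. Qed.

Lemma integrable_density : mu.-integrable setT (EFin \o g).
Proof.
apply/integrableP; split => //; under eq_integral do rewrite gee0_abs ?lee_fin//.
by rewrite -nug// probability_setT ltry.
Qed.

Lemma density_dominates : nu `<< mu.
Proof.
apply/null_content_dominatesP => A mA muA0.
rewrite nug//; apply: null_set_integral => //.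
exact: measurable_funTS.
Qed.

(** Both functions are integrable and have the same integral over every measurable set. *)
Lemma ae_eq_density_Radon_Nikodym :
  ae_eq mu setT (EFin \o g) ('d (charge_of_finite_measure nu) '/d mu).
Proof.
apply: integral_ae_eq => //; first exact: integrable_density.
  by apply: measurable_int; apply: Radon_Nikodym_integrable; exact: density_dominates.
move=> E _ mE; rewrite -nug// -Radon_Nikodym_integral//.
exact: density_dominates.
Qed.

(** Integrability of [h] is not assumed, since the formula serves to decide it. The change of
    variables for nonnegative functions is applied with another version of the derivative, which
    agrees with [g] almost everywhere. *)
Lemma ge0_density_change_of_variables (h : T -> \bar R) :
    measurable_fun setT h -> (forall x, 0 <= h x) ->
  \int[nu]_x h x = \int[mu]_x (h x * (g x)%:E).
Proof.
move=> mh h0; have numu := density_dominates.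
have mf := measurable_int _ (Radon_Nikodym_SigmaFinite.f_integrable numu).
rewrite -(Radon_Nikodym_SigmaFinite.change_of_variables numu)//.
apply: ae_eq_integral => //; [exact: emeasurable_funM..|].
apply: ae_eqe_mul2l; apply: ae_eq_sym; apply: integral_ae_eq => //.
  exact: integrable_density.
by move=> E _ mE; rewrite -nug// -Radon_Nikodym_SigmaFinite.f_integral.
Qed.

(** Translates the constraint on the competitors of the dual functional into [mu]-integrability of
    $\varphi g$. *)
Lemma integrable_densityE (phi : T -> R) : measurable_fun setT phi ->
  \int[nu]_x `|phi x|%:E = \int[mu]_x `|(phi x * g x)%:E|.
Proof.
move=> mphi; rewrite ge0_density_change_of_variables//; last first.
  by apply/measurable_EFinP; exact: measurableT_comp.
by apply: eq_integral => x _; rewrite -EFinM abse_EFin normrM (ger0_norm (g0 x)).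
Qed.

Lemma integral_density (phi : T -> R) : measurable_fun setT phi ->
    \int[nu]_x `|phi x|%:E < +oo ->
  \int[nu]_x (phi x)%:E = \int[mu]_x (phi x * g x)%:E.
Proof.
move=> mphi nuphi; have numu := density_dominates.
have iphi : nu.-integrable setT (EFin \o phi).
  by apply/integrableP; split => //; exact/measurable_EFinP.
rewrite -(Radon_Nikodym_change_of_variables numu measurableT iphi).
have mRN : measurable_fun setT ('d (charge_of_finite_measure nu) '/d mu).
  by apply: measurable_int; exact: Radon_Nikodym_integrable.
have mEphi : measurable_fun setT (EFin \o phi) by exact/measurable_EFinP.
under [RHS]eq_integral do rewrite EFinM.
apply: ae_eq_integral => //; [exact: emeasurable_funM..|].
by apply: ae_eqe_mul2l; apply: ae_eq_sym; exact: ae_eq_density_Radon_Nikodym.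
Qed.

Lemma safe_kl_density rho : (0 < rho)%R ->
  safe_kl rho nu mu = \int[mu]_x safe_kl_fun rho (g x).
Proof.
move=> rho0; have numu := density_dominates.
have mRN : measurable_fun setT ('d (charge_of_finite_measure nu) '/d mu).
  by apply: measurable_int; exact: Radon_Nikodym_integrable.
rewrite /safe_kl asboolT//; apply: ge0_ae_eq_integral => //.
- apply: measurableT_comp; first exact: measurable_safe_kl_fun.
  exact: measurableT_comp.
- by apply: measurableT_comp => //; exact: measurable_safe_kl_fun.
- by move=> x _; exact: safe_kl_fun_ge0.
- by move=> x _; exact: safe_kl_fun_ge0.
- apply: filterS ae_eq_density_Radon_Nikodym => x /= + _.
  by move=> <-.
Qed.

End density.

(** The version obtained is real and nonnegative at every point, so that Fenchel-Young can be
    applied to it without an exceptional null set. *)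
Lemma exists_density d (T : measurableType d) (R : realType)
    (nu mu : probability T R) : nu `<< mu ->
  exists g : T -> R, [/\ measurable_fun [set: T] g, forall x, 0 <= g x &
    forall A, measurable A -> (nu A = \int[mu]_(x in A) (g x)%:E)%E].
Proof.
move=> numu; pose f := Radon_Nikodym_SigmaFinite.f nu mu.
have ffin x : f x \is a fin_num by exact: Radon_Nikodym_SigmaFinite.f_fin_num.
exists (fine \o f); split => [|x|A mA].
- apply: measurableT_comp => //.
  exact: measurable_int (Radon_Nikodym_SigmaFinite.f_integrable numu).
- exact/fine_ge0/Radon_Nikodym_SigmaFinite.f_ge0.
- under eq_integral do rewrite /= fineK//.
  exact: Radon_Nikodym_SigmaFinite.f_integral.
Qed.

(** * Weak duality, and lower bounds from competing densities *)

Section weak_duality.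
Context d (T : measurableType d) (R : realType).
Variables (mu : probability T R) (rho : R) (phi : T -> R).
Hypotheses (rho0 : 0 < rho) (mphi : measurable_fun [set: T] phi).
Local Open Scope ereal_scope.

Lemma measurable_softplus_shift a :
  measurable_fun setT (fun x => (softplus rho (phi x - a))%:E).
Proof.
apply/measurable_EFinP; apply: measurableT_comp; last exact: measurable_funB.
exact: measurable_softplus.
Qed.

Lemma measurable_logistic_shift a :
  measurable_fun setT (fun x => logistic rho (phi x - a)).
Proof.
apply: measurableT_comp; last exact: measurable_funB.
exact: measurable_logistic.
Qed.

Lemma integrable_affine_density (g : T -> R) a :
    mu.-integrable setT (fun x => (phi x * g x)%:E) ->
    mu.-integrable setT (EFin \o g) ->
  mu.-integrable setT (fun x => ((phi x - a) * g x + 1)%:E).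
Proof.
move=> iphig ig.
have : mu.-integrable setT
    (fun x => (phi x * g x)%:E + ((- a)%:E * (g x)%:E + cst 1 x)).
  apply: integrableD => //; apply: integrableD => //; first exact: integrableZl.
  exact: finite_measure_integrable_cst.
apply: eq_integrable => // x _; rewrite /= -EFinM -!EFinD; congr EFin; ring.
Qed.

(** The integrand is the left side of Fenchel-Young at $s = \varphi - a$, $t = g$; both [g] and the
    constant 1 have integral one. *)
Lemma integral_affine_density (g : T -> R) a :
    mu.-integrable setT (fun x => (phi x * g x)%:E) ->
    mu.-integrable setT (EFin \o g) -> \int[mu]_x (g x)%:E = 1 ->
  \int[mu]_x ((phi x - a) * g x + 1)%:E
  = \int[mu]_x (phi x * g x)%:E + (1 - a)%:E.
Proof.
move=> iphig ig g1.
have i1 : mu.-integrable setT (cst 1 : T -> \bar R).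
  exact: finite_measure_integrable_cst.
have iag : mu.-integrable setT (fun x => (- a)%:E * (g x)%:E).
  exact: integrableZl.
transitivity (\int[mu]_x
    ((phi x * g x)%:E + ((- a)%:E * (g x)%:E + cst 1 x))).
  by apply: eq_integral => x _; rewrite /= -EFinM -!EFinD; congr EFin; ring.
rewrite integralD//; last exact: integrableD.
rewrite integralD// integralZl// g1 integral_cst//.
rewrite (_ : _ [set: T] = 1); last exact: probability_setT.
by rewrite !mule1 -EFinD (addrC (- a)%R).
Qed.

Lemma safe_kl_dual_le a : safe_kl_dual rho phi mu <=
  (a - 1)%:E + \int[mu]_x (softplus rho (phi x - a))%:E.
Proof.
apply: ge_ereal_sup => _ [nu /= nuphi <-].
have [numu|nnumu] := pselect (nu `<< mu); last first.
  by rewrite /safe_kl asboolF// addeNy leNye.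
have [g [mg g0 nug]] := exists_density numu.
rewrite (integral_density mg g0 nug)// (safe_kl_density mg g0 nug)//.
have iphig : mu.-integrable setT (fun x => (phi x * g x)%:E).
  apply/integrableP; split; last by rewrite -(integrable_densityE mg g0 nug).
  by apply/measurable_EFinP; exact: measurable_funM.
have ig := integrable_density mg g0 nug.
have g1 : \int[mu]_x (g x)%:E = 1 by rewrite -nug// probability_setT.
have mf : measurable_fun setT (fun x => safe_kl_fun rho (g x)).
  by apply: measurableT_comp => //; exact: measurable_safe_kl_fun.
have ms := measurable_softplus_shift a.
have f0 x : 0 <= safe_kl_fun rho (g x) by exact: safe_kl_fun_ge0.
have s0 x : 0 <= (softplus rho (phi x - a))%:E.
  by rewrite lee_fin softplus_ge0.
have : \int[mu]_x (phi x * g x)%:E + (1 - a)%:E <=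
    \int[mu]_x safe_kl_fun rho (g x) + \int[mu]_x (softplus rho (phi x - a))%:E.
  rewrite -ge0_integralD// -integral_affine_density//.
  (* Unless the bound is trivial, the right integrand is nonnegative with finite integral, hence
     integrable, and the integrals can be compared. *)
  have [->|fin] := eqVneq (\int[mu]_x (safe_kl_fun rho (g x) +
      (softplus rho (phi x - a))%:E)) +oo; first exact: leey.
  apply: le_integral => //.
  - exact: integrable_affine_density.
  - apply/integrableP; split; first exact: emeasurable_funD.
    under eq_integral do rewrite gee0_abs ?adde_ge0//.
    by rewrite ltey.
  - by move=> x _; exact: safe_kl_fun_young.
have := integrable_fin_num measurableT iphig.
have : 0 <= \int[mu]_x (softplus rho (phi x - a))%:E by exact: integral_ge0.
have : 0 <= \int[mu]_x safe_kl_fun rho (g x) by exact: integral_ge0.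
(* Only this integral is known to be finite. An infinite divergence makes the left side $-\infty$;
   otherwise an infinite softplus integral makes the right side $+\infty$. *)
case: (\int[mu]_x (phi x * g x)%:E) => // r.
case: (\int[mu]_x safe_kl_fun rho (g x)) => // [k|]; last by rewrite leNye.
case: (\int[mu]_x (softplus rho (phi x - a))%:E) => // [s|].
  move=> _ _ _; rewrite -!EFinD !lee_fin; lra.
by move=> _ _ _ _; rewrite addey// leey.
Qed.

Lemma safe_kl_dual_ge (g : T -> R) : measurable_fun [set: T] g ->
    (forall x, (0 <= g x)%R) -> \int[mu]_x (g x)%:E = 1 ->
    mu.-integrable setT (fun x => (phi x * g x)%:E) ->
  \int[mu]_x (phi x * g x)%:E - \int[mu]_x safe_kl_fun rho (g x)
    <= safe_kl_dual rho phi mu.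
Proof.
move=> mg g0 g1 /integrableP[_ iphig].
have [nu nug] := exists_density_probability mg g0 g1.
have nuphi : \int[nu]_x `|phi x|%:E < +oo.
  by rewrite (integrable_densityE mg g0 nug).
apply: ereal_sup_ubound; exists nu => //=.
by rewrite (integral_density mg g0 nug)// (safe_kl_density mg g0 nug).
Qed.

End weak_duality.

(** * The optimal density when the positive part of [phi] is integrable *)

Section optimal_density.
Context d (T : measurableType d) (R : realType).
Variables (mu : probability T R) (rho : R) (phi : T -> R).
Hypotheses (rho0 : 0 < rho) (mphi : measurable_fun [set: T] phi).
Local Open Scope ereal_scope.

Let mlog a := measurable_logistic_shift rho0 mphi a.

Let logistic_bound s : (`|logistic rho s| <= 1 / rho)%R.
Proof. by rewrite ger0_norm ?logistic_ge0// ltW// logistic_lt. Qed.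

Lemma integrable_logistic_shift a :
  mu.-integrable setT (EFin \o (fun x => logistic rho (phi x - a))).
Proof.
apply: (le_integrable measurableT (g := EFin \o cst (1 / rho)%R)).
- exact/measurable_EFinP.
- by move=> x _; rewrite !abse_EFin lee_fin (le_trans (logistic_bound _))// ler_norm.
- exact: finite_measure_integrable_cst.
Qed.

(** Dominated convergence with the constant $1/\rho$. The limit is the same for all [s] because the
    lemma is meant for shifts tending to $\pm\infty$. *)
Lemma cvg_integral_logistic_shift (a_ : R^nat) (l : R) :
    (forall s, logistic rho (s - a_ n) @[n --> \oo] --> l)%R ->
  \int[mu]_x (logistic rho (phi x - a_ n))%:E @[n --> \oo] --> l%:E.
Proof.
move=> al.
have [] := @dominated_convergence _ _ _ mu setT measurableT
  (fun n x => (logistic rho (phi x - a_ n))%:E) (cst l%:E)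
  (cst (1 / rho)%:E).
- by move=> n; exact/measurable_EFinP.
- by [].
- by apply: aeW => x _; apply/cvg_EFin; [exact: nearW|exact: al].
- exact: finite_measure_integrable_cst.
- by apply: aeW => x n _; rewrite abse_EFin lee_fin.
move=> _ _; rewrite integral_cst//.
by rewrite (_ : _ [set: T] = 1) ?mule1//; exact: probability_setT.
Qed.

Lemma continuous_integral_logistic_shift :
  continuous (fun a => \int[mu]_x logistic rho (phi x - a))%R.
Proof.
move=> a.
apply: (@continuity_under_integral _ _ _ mu (fun a x => logistic rho (phi x - a))
  setT measurableT (a - 1)%R (a + 1)%R _ _ (cst (1 / rho)%R)).
- by move=> b _; exact: integrable_logistic_shift.
- apply: aeW => x _ b _; apply: (@continuous_comp _ _ _ (fun b => phi x - b)%R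
    (logistic rho)); last exact: continuous_logistic.
  by apply: cvgB; [exact: cvg_cst|exact: cvg_id].
- exact: finite_measure_integrable_cst.
- by move=> b _; apply: aeW => x _.
- by rewrite inE/= in_itv/=; apply/andP; split; lra.
Qed.

(** The total mass is continuous in [a], tends to 0 at $+\infty$ and to $1/\rho > 1$ at
    $-\infty$. *)
Lemma exists_integral_logistic_eq1 : (rho < 1)%R ->
  exists a, \int[mu]_x (logistic rho (phi x - a))%:E = 1.
Proof.
move=> rho1; pose F a := (\int[mu]_x logistic rho (phi x - a))%R.
have FE a : (F a)%:E = \int[mu]_x (logistic rho (phi x - a))%:E.
  by rewrite /F /Rintegral fineK// integrable_fin_num//;
    exact: integrable_logistic_shift.
have cvgF (a_ : R^nat) (l : R) : (forall s, logistic rho (s - a_ n) @[n --> \oo] --> l)%R ->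
    (F (a_ n) @[n --> \oo] --> l)%R.
  move=> al; have := cvg_integral_logistic_shift al.
  by under eq_cvg do rewrite -FE; move/fine_cvg.
have expn0 (s : R) : (expR (s - n%:R) @[n --> \oo] --> 0)%R.
  have -> : (fun n => expR (s - n%:R)) = (fun n => expR s * expR (- n%:R))%R.
    by apply/funext => n; rewrite expRD.
  by rewrite -(mulr0 (expR s)); apply: cvgMl_tmp; exact: cvgn_expR.
have F0 : (F n%:R @[n --> \oo] --> 0)%R.
  apply: cvgF => s; apply: (squeeze_cvgr _ (cvg_cst 0%R) (expn0 s)).
  by apply: nearW => n; rewrite logistic_ge0//= logistic_le_expR.
have F1 : (F (- n%:R) @[n --> \oo] --> rho^-1)%R.
  apply: cvgF => s; apply: cvgV; first by rewrite gt_eqF.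
  have -> : (fun n => rho + expR (- (s - - n%:R)))%R =
      (cst rho \+ (fun n => expR (- s - n%:R)))%R.
    by apply/funext => n /=; rewrite opprK opprD.
  suff : ((cst rho \+ (fun n => expR (- s - n%:R))) @ \oo --> rho + 0)%R.
    by rewrite addr0.
  by apply: cvgD; [exact: cvg_cst|exact: expn0].
have [n [Fn FNn]] : exists n, (F n%:R <= 1 /\ 1 <= F (- n%:R))%R.
  have /filter_ex[n] : \forall n \near \oo,
      ((F n%:R <= 1)%R /\ (1 <= F (- n%:R))%R).
    near=> n; split; apply/ltW; near: n.
    - by apply: (cvgr_lt _ F0); exact: ltr01.
    - by apply: (cvgr_gt _ F1); rewrite invf_gt1.
  by exists n.
have [|||a _ Fa] := @IVT R F (- n%:R)%R n%:R 1%R.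
- by rewrite (@le_trans _ _ 0%R)// oppr_le0.
- by apply: continuous_subspaceT; exact: continuous_integral_logistic_shift.
- by rewrite ge_min Fn orbT le_max FNn.
by exists a; rewrite -FE Fa.
Unshelve. all: by end_near. Qed.

Lemma safe_kl_dual_attained : (rho < 1)%R ->
    \int[mu]_x (Num.max (phi x) 0)%:E < +oo ->
  exists a, (a - 1)%:E + \int[mu]_x (softplus rho (phi x - a))%:E
    <= safe_kl_dual rho phi mu.
Proof.
move=> rho1 phioo; have [a g1] := exists_integral_logistic_eq1 rho1.
exists a; pose g x := logistic rho (phi x - a).
have ig : mu.-integrable setT (EFin \o g) by exact: integrable_logistic_shift.
have g0 x : (0 <= g x)%R by rewrite logistic_ge0.
have iphi : mu.-integrable setT (fun x => (Num.max (phi x) 0)%:E).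
  apply/integrableP; split.
    by apply/measurable_EFinP; exact: measurable_maxr.
  rewrite (eq_integral (fun x => (Num.max (phi x) 0)%:E))// => x _.
  by rewrite gee0_abs// lee_fin le_max lexx orbT.
have iphig : mu.-integrable setT (fun x => (phi x * g x)%:E).
  (* Where $\varphi \ge 0$, the bound $g \le 1/\rho$ suffices. Where $\varphi < 0$, $g \le
     e^{\varphi - a}$ gives $|\varphi| g \le e^{-a}$, because $x \le e^x$ at $x = -\varphi$. *)
  apply: (le_integrable measurableT (g := (fun x =>
      (1 / rho)%:E * (Num.max (phi x) 0)%:E + cst (expR (- a))%:E x))).
  - by apply/measurable_EFinP; apply: measurable_funM => //; exact: mlog.
  - move=> x _; rewrite /= lee_fin.
    rewrite [leRHS]ger0_norm; last first.
      by rewrite addr_ge0 ?expR_ge0// mulr_ge0 ?le_max ?lexx ?orbT// divr_ge0 ?ltW.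
    rewrite normrM (ger0_norm (g0 x)).
    have [phi0|phi0] := leP 0%R (phi x).
      rewrite ger0_norm// (le_trans (y := (1 / rho * phi x)%R))//.
        by rewrite mulrC ler_wpM2r// ltW// logistic_lt.
      by rewrite lerDl expR_ge0.
    rewrite ltr0_norm// mulr0 add0r.
    rewrite (le_trans (y := (- phi x * expR (phi x - a))%R))//.
      apply: ler_wpM2l; first by rewrite oppr_ge0 ltW.
      exact: logistic_le_expR.
    rewrite expRD mulrA -[leRHS]mul1r ler_wpM2r ?expR_ge0//.
    rewrite -[in expR (phi x)](opprK (phi x)) expRN ler_pdivrMr ?expR_gt0// mul1r.
    by rewrite (le_trans _ (expR_ge1Dx _))// lerDr.
  - apply: integrableD => //; first exact: integrableZl.
    exact: finite_measure_integrable_cst.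
have mg : measurable_fun setT g by exact: mlog.
apply: le_trans (safe_kl_dual_ge rho0 mphi mg g0 g1 iphig).
have mf : measurable_fun setT (fun x => safe_kl_fun rho (g x)).
  by apply: measurableT_comp => //; exact: measurable_safe_kl_fun.
have ms := measurable_softplus_shift rho mphi a.
have f0 x : 0 <= safe_kl_fun rho (g x) by exact: safe_kl_fun_ge0.
have s0 x : 0 <= (softplus rho (phi x - a))%:E.
  by rewrite lee_fin softplus_ge0.
have := integral_affine_density a iphig ig g1.
(* The equality case of Fenchel-Young splits the affine integrand into divergence and softplus
   terms. *)
under eq_integral => x _.
  rewrite -(subrK (softplus rho (phi x - a)) (_ + 1)%R) EFinD.
  rewrite -safe_kl_fun_logistic//; over.
rewrite ge0_integralD//; last by move=> x _; exact: f0.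
have := integrable_fin_num measurableT iphig.
have : 0 <= \int[mu]_x (softplus rho (phi x - a))%:E by exact: integral_ge0.
have : 0 <= \int[mu]_x safe_kl_fun rho (g x) by exact: integral_ge0.
rewrite -/g.
(* Two nonnegative integrals with a finite sum are finite, so the equality can be rearranged in the
   reals. *)
case: (\int[mu]_x (phi x * g x)%:E) => // r.
case: (\int[mu]_x safe_kl_fun rho (g x)) => // [k|].
  case: (\int[mu]_x (softplus rho (phi x - a))%:E) => // s _ _ _.
  rewrite -!EFinD => -[] h; rewrite lee_fin; lra.
by move=> _; case: (\int[mu]_x (softplus rho (phi x - a))%:E).
Qed.

End optimal_density.

(** * Infinite dual value when the positive part of [phi] is not integrable *)

Lemma safe_kl_fun_le (R : realType) (rho t : R) : 0 < rho -> 0 <= t <= 1 / rho ->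
  (safe_kl_fun rho t <= ((1 / rho) ^+ 2 + 1)%:E)%E.
Proof.
move=> rho0 /[dup] tb /andP[t0 t1]; rewrite /safe_kl_fun tb lee_fin.
have q0 : 0 <= 1 - rho * t by rewrite subr_ge0 mulrC -ler_pdivlMr.
(* From $\ln t < t$ for $t > 0$; a crude bound is enough, as only boundedness matters. *)
have h1 : t * ln t <= (1 / rho) ^+ 2.
  rewrite (le_trans (y := t * t))//; last by rewrite -expr2 lerXn2r ?nnegrE ?(le_trans t0).
  have [->|tn0] := eqVneq t 0; first by rewrite !mul0r.
  by rewrite ler_wpM2l// ltW// ln_sublinear// lt_neqAle eq_sym tn0.
have h2 : (1 - rho * t) / rho * ln (1 - rho * t) <= 0.
  rewrite mulr_ge0_le0 ?divr_ge0 ?(ltW rho0)// ln_le0// gerBl mulr_ge0//.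
  exact: ltW.
lra.
Qed.

Section infinite_positive_part.
Context d (T : measurableType d) (R : realType).
Variables (mu : probability T R) (phi : T -> R).
Hypothesis mphi : measurable_fun [set: T] phi.
Local Open Scope ereal_scope.

Let slab (a b : R) := phi @^-1` `[a, b].

Let mslab a b : measurable (slab a b).
Proof. by rewrite -[slab a b]setTI; exact: mphi. Qed.

(** As [phi] is real-valued, the symmetric slabs increase to the whole space. *)
Lemma exists_slab_measure_gt (r : R) : (r < 1)%R ->
  exists N : nat, r%:E < mu (slab (- N%:R) N%:R).
Proof.
move=> r1.
have cvg1 : mu (slab (- n%:R)%R n%:R) @[n --> \oo] --> 1.
  rewrite -(@probability_setT _ _ _ mu).
  suff -> : [set: T] = \bigcup_n slab (- n%:R)%R n%:R.
    apply: nondecreasing_cvg_mu => //; first exact: bigcup_measurable.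
    move=> m n mn; apply/subsetPset => x; rewrite /slab /= !in_itv/=.
    have : (m%:R <= n%:R :> R)%R by rewrite ler_nat.
    by move=> mn' /andP[? ?]; apply/andP; split; lra.
  apply/esym; rewrite -subTset => x _.
  exists (Num.bound `|phi x|%R) => //; rewrite /slab /= in_itv/= -ler_norml.
  by rewrite ltW// archi_boundP.
have /filter_ex[N ?] : \forall n \near \oo, r%:E < mu (slab (- n%:R)%R n%:R).
  apply: filterS (cvgr_gt _ (fine_cvg cvg1) _ r1) => n /= rn.
  by rewrite -[mu _]fineK ?fin_num_measure// lte_fin.
by exists N.
Qed.

(** Monotone convergence: $\varphi + a$ is nonnegative on the slabs, whose union is $\{\varphi \ge
    -a\}$. There $\varphi + a$ dominates the positive part of $\varphi$, which vanishes
    elsewhere. *)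
Lemma exists_slab_integral_ge (a M : R) (N : nat) :
    \int[mu]_x (Num.max (phi x) 0)%:E = +oo -> (0 <= a)%R ->
  exists n : nat, (N <= n)%N /\
    M%:E <= \int[mu]_(x in slab (- a) n%:R) (phi x + a)%:E.
Proof.
move=> phioo a0.
have ndslab : nondecreasing_seq (fun n : nat => slab (- a)%R n%:R).
  move=> m n mn; apply/subsetPset => x; rewrite /slab /= !in_itv/=.
  have : (m%:R <= n%:R :> R)%R by rewrite ler_nat.
  by move=> mn' /andP[? ?]; apply/andP; split; lra.
have mphia : measurable_fun setT (fun x => (phi x + a)%:E).
  by apply/measurable_EFinP; exact: measurable_funD.
have phia0 (n : nat) x : slab (- a)%R n%:R x -> 0 <= (phi x + a)%:E.
  by rewrite /slab /= in_itv/= => /andP[? _]; rewrite lee_fin; lra.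
have := @ge0_nondecreasing_set_cvg_integral _ _ _ _ _ mu ndslab
  (fun n => mslab _ _) (fun n => measurable_funTS mphia) phia0.
set U := \bigcup_n _.
have -> : \int[mu]_(x in U) (phi x + a)%:E = +oo.
  apply/eqP; rewrite -leye_eq -phioo [leRHS]integral_mkcond.
  have mU : measurable U by exact: bigcup_measurable.
  apply: ge0_le_integral => //.
  - by move=> x _; rewrite lee_fin le_max lexx orbT.
  - by apply/measurable_EFinP; exact: measurable_maxr.
  - exact/(measurable_restrictT _ mU)/measurable_funTS.
  - move=> x _; rewrite patchE; case: ifPn => [|xU].
      rewrite inE => -[n _ /= /phia0]; rewrite !lee_fin ge_max => h.
      by rewrite lerDl a0.
    rewrite lee_fin ge_max lexx andbT leNgt; apply: contra xU => phi0.
    rewrite inE; exists (Num.bound (phi x)) => //; rewrite /slab /= in_itv/=.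
    rewrite (le_trans _ (ltW phi0)) ?oppr_le0//=.
    by rewrite ltW// archi_boundP// ltW.
move=> /cvgeyPge /(_ M) hM.
have /filter_ex[n [? ?]] : \forall n \near \oo, (N <= n)%N /\
    M%:E <= \int[mu]_(x in slab (- a) n%:R) (phi x + a)%:E.
  by apply: filterI => //; exact: nbhs_infty_ge.
by exists n.
Qed.

(* The competitors are the measures [mu] conditioned on [- N <= phi <= n]:
   [N] is fixed so that their densities are at most [1 / rho], while [n] tends
   to infinity. *)
Lemma safe_kl_dual_infinite (rho : R) : (0 < rho)%R -> (rho < 1)%R ->
  \int[mu]_x (Num.max (phi x) 0)%:E = +oo -> safe_kl_dual rho phi mu = +oo.
Proof.
move=> rho0 rho1 phioo; have [N muN] := exists_slab_measure_gt rho1.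
apply: eq_infty => r.
pose C : R := ((1 / rho) ^+ 2 + 1)%R.
(* [C] will absorb the divergence, and $N + 1$ the constant $1 - a$ of [integral_affine_density] at
   $a = -N$. *)
have [n [Nn Mn]] := exists_slab_integral_ge (r + N%:R + 1 + C) N phioo (ler0n R N).
set B := slab (- N%:R) n%:R in Mn.
have mB : measurable B by exact: mslab.
have rhoB : rho%:E < mu B.
  apply: lt_le_trans muN _; apply: le_measure; rewrite ?inE//.
  move=> x; rewrite /B /slab /= !in_itv/= => /andP[-> h] /=.
  by rewrite (le_trans h)// ler_nat.
pose p := fine (mu B).
have pE : p%:E = mu B by rewrite fineK// fin_num_measure.
have rhop : (rho < p)%R by rewrite -lte_fin pE.
have p0 : (0 < p)%R by exact: lt_trans rhop.
have p1 : (p <= 1)%R by rewrite -lee_fin pE probability_le1.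
pose g x := (\1_B x / p)%R.
have mg : measurable_fun setT g by apply: measurable_funM => //; exact: measurable_indic.
have g0 x : (0 <= g x)%R by rewrite divr_ge0// ltW.
have gE x : (phi x * g x)%R = (\1_B x * (phi x / p))%R by rewrite /g; ring.
have g1 : \int[mu]_x (g x)%:E = 1.
  under eq_integral do rewrite EFinM muleC.
  rewrite ge0_integralZl//; last 2 first.
    by apply/measurable_EFinP; exact: measurable_indic.
    by rewrite lee_fin invr_ge0 ltW.
  rewrite integral_indic// setIT (_ : _ B = p%:E); last exact/esym/pE.
  by rewrite -EFinM mulVf// gt_eqF.
(* [B] contains the symmetric slab of measure above [rho], because $N \le n$; hence $1/p \le 1/\rho$
   and $f_\rho(g)$ is finite. *)
have gle x : (0 <= g x <= 1 / rho)%R.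
  rewrite g0 /= /g ler_pM ?invr_ge0 ?(ltW p0)//.
  by rewrite lef_pV2 ?posrE// ltW.
have iphig : mu.-integrable setT (fun x => (phi x * g x)%:E).
  apply: (le_integrable measurableT (g := EFin \o cst ((N%:R + n%:R) / p)%R)).
  - by apply/measurable_EFinP; exact: measurable_funM.
  - move=> x _; rewrite /= lee_fin (le_trans _ (ler_norm _))// gE indicE.
    case: (boolP (x \in B)) => [|_]; last first.
      by rewrite mul0r normr0 divr_ge0 ?addr_ge0// ltW.
    rewrite inE /B /slab /= in_itv/= => /andP[h1 h2].
    rewrite mul1r normrM (gtr0_norm (_ : 0 < p^-1)%R) ?invr_gt0//.
    rewrite ler_wpM2r ?invr_ge0 ?(ltW p0)// ler_norml.
    have : (0 <= N%:R :> R)%R by []. have : (0 <= n%:R :> R)%R by [].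
    by move=> ? ?; apply/andP; split; lra.
  - exact: finite_measure_integrable_cst.
have ig : mu.-integrable setT (EFin \o g).
  apply/integrableP; split; first exact/measurable_EFinP.
  by under eq_integral do rewrite gee0_abs ?lee_fin//; rewrite g1 ltry.
apply: le_trans (safe_kl_dual_ge rho0 mphi mg g0 g1 iphig).
have mf : measurable_fun setT (fun x => safe_kl_fun rho (g x)).
  by apply: measurableT_comp => //; exact: measurable_safe_kl_fun.
have KC : \int[mu]_x safe_kl_fun rho (g x) <= C%:E.
  have -> : C%:E = \int[mu]_x cst C%:E x.
    rewrite integral_cst// (_ : _ [set: T] = 1) ?mule1//.
    exact: probability_setT.
  apply: ge0_le_integral => // x _; first exact: safe_kl_fun_ge0.
  exact: safe_kl_fun_le.
have K0 : 0 <= \int[mu]_x safe_kl_fun rho (g x).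
  by apply: integral_ge0 => x _; exact: safe_kl_fun_ge0.
have : (r + N%:R + 1 + C)%:E <=
    \int[mu]_x (phi x * g x)%:E + (1 - - N%:R)%:E.
  (* On [B], $p \le 1$ gives $\varphi + N \le (\varphi + N)/p$; off [B] the affine integrand is
     1. *)
  rewrite -integral_affine_density//; apply: (le_trans Mn).
  rewrite integral_mkcond; apply: ge0_le_integral => //.
  - move=> x _; rewrite patchE; case: ifPn => //.
    by rewrite inE /B /slab /= in_itv/= => /andP[h _]; rewrite lee_fin; lra.
  - apply/(measurable_restrictT _ mB)/measurable_funTS/measurable_EFinP.
    exact: measurable_funD.
  - by move: (integrable_affine_density (- N%:R) iphig ig) => /measurable_int.
  - move=> x _; rewrite patchE opprK /g indicE; case: ifPn => [|_].
      rewrite inE /B /slab /= in_itv/= => /andP[h _]; rewrite lee_fin.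
      have h0 : (0 <= phi x + N%:R)%R by lra.
      rewrite (le_trans (y := (phi x + N%:R) * (1 / p))%R)//.
        by rewrite ler_peMr// div1r invf_ge1.
      by rewrite lerDl.
    by rewrite mul0r mulr0 add0r lee_fin.
have := integrable_fin_num measurableT iphig.
move: K0 KC; case: (\int[mu]_x (phi x * g x)%:E) => // s.
case: (\int[mu]_x safe_kl_fun rho (g x)) => // k.
rewrite -!EFinD !lee_fin => _ kC _ h; lra.
Qed.

End infinite_positive_part.

(** * The conjugate formula and the dual representation *)

Theorem lemma2p3 (R : realType) (rho : R) (hrho0 : 0 < rho) (hrho1 : rho < 1) :
  (forall s : R,
     conjugate_nonneg (safe_kl_fun rho) s
     = (1 / rho * ln (1 + rho * expR s) - 1)%:E) /\
  (forall (d : measure_display) (T : measurableType d) (mu : probability T R)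
          (phi : T -> R), measurable_fun [set: T] phi ->
     safe_kl_dual rho phi mu
     = ereal_inf (range (fun alpha : R =>
         ((alpha - 1)%:E
          + (1 / rho)%:E
            * \int[mu]_x (ln (1 + rho * expR (phi x - alpha)))%:E)%E))).
Proof.
split=> [s|d T mu phi mphi]; first exact: conjugate_safe_kl_fun.
have hE a : ((1 / rho)%:E * \int[mu]_x (ln (1 + rho * expR (phi x - a)))%:E =
    \int[mu]_x (softplus rho (phi x - a))%:E)%E.
  rewrite -ge0_integralZl//.
  - apply/measurable_EFinP; apply: measurableT_comp => //.
    apply: measurable_funD => //; apply: measurable_funM => //.
    by apply: measurableT_comp => //; exact: measurable_funB.
  - move=> x _; rewrite lee_fin ln_ge0// lerDl mulr_ge0 ?expR_ge0//.
    exact: ltW.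
  - by rewrite lee_fin divr_ge0// ltW.
apply/eqP; rewrite eq_le; apply/andP; split.
  apply/ereal_infP => _ [a _ <-]; rewrite hE.
  exact: safe_kl_dual_le.
(* If the positive part has infinite integral, the supremum is $+\infty$; otherwise some [a] has an
   objective value at most the supremum. *)
have [phioo|] := eqVneq (\int[mu]_x (Num.max (phi x) 0)%:E)%E +oo%E.
  by rewrite safe_kl_dual_infinite// leey.
rewrite -ltey => /(safe_kl_dual_attained hrho0 mphi hrho1)[a ha].
apply: le_trans ha; apply: ereal_inf_lbound; exists a => //.
by rewrite hE.
Qed.
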